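(* Let $E$ be a real Banach space. Then every non-degenerate order interval $[f,g]=\{h\in FBL[E]: f\le h\le g\}$ of $FBL[E]$ (where $f,g\in FBL[E]$, $f\le g$, $f\ne g$) has density character equal to the density character of $E$.
   Context: The density character of a topological space is the least cardinality of a dense subset. For a real Banach space $E$ with dual $E^*$ and closed unit ball $B_E$, let $H[E]$ be the vector space of all positively homogeneous functions $f:E^*\to\mathbb R$ (i.e. $f(\lambda x^* )=\lambda f(x^* )$ for all $\lambda>0$). For $f\in H[E]$ put $\|f\|_{FBL[E]}:=\sup\{\sum_{k=1}^n|f(x_k^* )| : n\in\mathbb N,\ x_1^*,\dots,x_n^*\in E^*,\ \sup_{x\in B_E}\sum_{k=1}^n|x_k^*(x)|\le 1\}$. $H_0[E]:=\{f\in H[E]:\|f\|_{FBL[E]}<\infty\}$ is a Banach lattice with this norm and pointwise order/operations. For $x\in E$ let $\delta_x(x^* )=x^*(x)$. $FBL[E]$ is the closed sublattice of $H_0[E]$ generated by $\{\delta_x:x\in E\}$. *)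

(* Defs.v *)
From HB Require Import structures.
From mathcomp Require Import all_boot all_order all_algebra.
From mathcomp Require Import all_classical all_reals all_analysis.
Set Implicit Arguments. Unset Strict Implicit. Unset Printing Implicit Defensive.
Import Order.TTheory GRing.Theory Num.Theory.
Import numFieldNormedType.Exports.
Local Open Scope classical_set_scope.
Local Open Scope ring_scope.

Section FBL.
Context {R : realType} {E : normedModType R}.

Definition is_linfun (phi : E -> R) : Prop :=
  forall (a : R) (x y : E), phi (a *: x + y) = a * phi x + phi y.

Definition Dual : Type := {phi : E -> R | is_linfun phi /\ continuous phi}.

Definition dual_app (phi : Dual) : E -> R := proj1_sig phi.

(* H[E] : positively homogeneous functions E^* -> R.
   f (lambda x^* ) = lambda f(x^* ), where psi = lambda phi is expressed
   pointwise (psi is uniquely determined by phi and lambda). *)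
Definition pos_homogeneous (f : Dual -> R) : Prop :=
  forall (lam : R) (phi psi : Dual), 0 < lam ->
    (forall x, dual_app psi x = lam * dual_app phi x) -> f psi = lam * f phi.

Definition admissible (n : nat) (xs : 'I_n -> Dual) : Prop :=
  forall x : E, `|x| <= 1 -> \sum_(k < n) `|dual_app (xs k) x| <= 1.

Definition fbl_norm (f : Dual -> R) : \bar R :=
  ereal_sup [set r : \bar R | exists (n : nat) (xs : 'I_n -> Dual),
               admissible xs /\ r = (\sum_(k < n) `|f (xs k)|)%:E].

Definition H0 : set (Dual -> R) :=
  [set f | pos_homogeneous f /\ (fbl_norm f < +oo)%E].

Definition delta (x : E) : Dual -> R := fun phi => dual_app phi x.

Definition closed_sublattice_containing_deltas (S : set (Dual -> R)) : Prop :=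
  S `<=` H0 /\
      (forall x, S (delta x)) /\
      (forall f g, S f -> S g -> S (f \+ g)) /\
      (forall (a : R) f, S f -> S (fun phi => a * f phi)) /\
      (forall f g, S f -> S g -> S (fun phi => Num.max (f phi) (g phi))) /\
      (forall f g, S f -> S g -> S (fun phi => Num.min (f phi) (g phi))) /\
    (forall h, H0 h ->
        (forall e : R, 0 < e -> exists2 s, S s & (fbl_norm (h \- s)%R < e%:E)%E) ->
        S h).

Definition FBL : set (Dual -> R) :=
  \bigcap_(S in closed_sublattice_containing_deltas) S.

Definition order_interval (f g : Dual -> R) : set (Dual -> R) :=
  [set h | FBL h /\ (forall phi, f phi <= h phi) /\ (forall phi, h phi <= g phi)].

End FBL.

Definition dense_in {T : Type} {R : realType} (d : T -> T -> \bar R)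
    (A D : set T) : Prop :=
  D `<=` A /\
  forall x, A x -> forall e : R, 0 < e -> exists2 y, D y & (d x y < e%:E)%E.

(* dens(A, dA) <= dens(B, dB): the density character (least cardinality of a
   dense subset) of A is at most that of B, i.e. for every dense subset D of B
   there is a dense subset D' of A with card D' <= card D. *)
Definition density_le {T U : Type} {R : realType}
    (dA : T -> T -> \bar R) (A : set T) (dB : U -> U -> \bar R) (B : set U)
    : Prop :=
  forall D : set U, dense_in dB B D ->
    exists D' : set T, dense_in dA A D' /\ (D' #<= D)%card.

Definition density_eq {T U : Type} {R : realType}
    (dA : T -> T -> \bar R) (A : set T) (dB : U -> U -> \bar R) (B : set U)
    : Prop :=
  density_le dA A dB B /\ density_le dB B dA A.

Definition norm_dist {R : realType} {E : normedModType R} (x y : E) : \bar R :=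
  (`|x - y|)%:E.

Definition fbl_dist {R : realType} {E : normedModType R}
    (f g : @Dual R E -> R) : \bar R := fbl_norm (f \- g).

(* Main.v *)
Require Import Defs.
From HB Require Import structures.
From mathcomp Require Import all_boot all_order all_algebra.
From mathcomp Require Import all_classical all_reals all_analysis.
From mathcomp Require Import ring lra.
Set Implicit Arguments. Unset Strict Implicit. Unset Printing Implicit Defensive.
Import Order.TTheory GRing.Theory Num.Theory.
Import numFieldNormedType.Exports.
Local Open Scope classical_set_scope.
Local Open Scope ring_scope.

(* Upper bound: the rational lattice combinations of the [delta d], for [d] in a
   dense subset [D] of [E], are as many as [D] and are dense in [FBL]; the
   1-Lipschitz retraction [h |-> (h \/ f) /\ g] maps them onto a dense subset of
   [[f, g]].
   Lower bound: pick [phi0] with [f phi0 < g phi0] and [y] with [phi0 y] halfway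
   between these two values.  By norm continuity of [f] and [g] there is a norm
   ball around [phi0] on which [delta (y + x)] stays between [f] and [g] for all
   small [x].  Clipping does not change [delta (y + x)] there, and by Hahn-Banach
   the ball norms [E], so [x |-> (delta (y + x) \/ f) /\ g] is bounded below on a
   ball of [E], whose multiples cover [E].
   Both parts use [kappa * kappa = kappa] for infinite [kappa]. *)

(** * Infinite cardinals *)

(** Zorn's lemma for the sets whose union with [G0] satisfies [P]; the seed [G0] takes care of the
    empty chain. *)
Lemma Zorn_bigcup_above (T : Type) (P : set (set T)) (G0 : set T) :
    P G0 ->
    (forall F : set (set T), F !=set0 -> F `<=` P -> total_on F subset ->
      P (\bigcup_(X in F) X)) ->
  exists A, [/\ P A, G0 `<=` A & forall B, A `<=` B -> P B -> B `<=` A].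
Proof.
move=> PG0 Pbig.
pose Q : set (set T) := fun G => P (G0 `|` G).
have [F FQ totF|A [QA Amax]] := @Zorn_bigcup T Q.
  have [->|/set0P[X FX]] := eqVneq F set0.
    by rewrite /Q bigcup_set0 setU0.
  rewrite /Q.
  have -> : G0 `|` \bigcup_(X in F) X = \bigcup_(Y in (setU G0) @` F) Y.
    apply/seteqP; split=> [x [G0x|[Y FY Yx]]|x [_ [Y FY <-] [G0x|Yx]]].
    - by exists (G0 `|` X); [exists X|left].
    - by exists (G0 `|` Y); [exists Y|right].
    - by left.
    - by right; exists Y.
  apply: Pbig.
  - by exists (G0 `|` X); exists X.
  - by move=> _ [Y FY <-]; exact: FQ.
  - move=> _ _ [Y FY <-] [Z FZ <-].
    by case: (totF _ _ FY FZ) => YZ; [left|right]; exact: setUS.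
exists (G0 `|` A); split=> // B AB PB x Bx; apply: contrapT => nAx.
apply: (Amax B); last first.
  by rewrite /Q (_ : G0 `|` B = B)//; apply/setUidPr => y ?; apply: AB; left.
split; first by move=> y Ay; apply: AB; right.
by move=> /(_ _ Bx) Ax; apply: nAx; right.
Qed.

(** The equivalence encodes functionality and injectivity at once: [G] is the graph of a bijection
    between its projections. *)
Definition partial_injection (U V : Type) (G : set (U * V)) :=
  forall p q, G p -> G q -> (p.1 = q.1 <-> p.2 = q.2).

Lemma partial_injection_bigcup (U V : Type) (F : set (set (U * V))) :
  F `<=` @partial_injection U V -> total_on F subset ->
  partial_injection (\bigcup_(X in F) X).
Proof.
move=> Fpi totF p q [X FX Xp] [Y FY Yq].
by case: (totF _ _ FX FY) => XY; [apply: (Fpi Y)|apply: (Fpi X)] => //; exact: XY.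
Qed.

Lemma partial_injectionU (U V : Type) (G H : set (U * V)) :
  partial_injection G -> partial_injection H ->
  (forall p q, G p -> H q -> p.1 <> q.1 /\ p.2 <> q.2) ->
  partial_injection (G `|` H).
Proof.
move=> Gpi Hpi GH p q [Gp|Hp] [Gq|Hq].
- exact: Gpi.
- by have [? ?] := GH _ _ Gp Hq; split.
- by have [? ?] := GH _ _ Gq Hp; split=> /esym.
- exact: Hpi.
Qed.

(** A maximal partial injection inside the product of [A] and [B] exhausts [A] or [B], since
    otherwise one more pair could be adjoined. *)
Lemma injection_comparable (T : Type) (A B : set T) :
  (exists2 h : T -> T, set_fun A B h & set_inj A h) \/
  (exists2 h : T -> T, set_fun B A h & set_inj B h).
Proof.
pose P (G : set (T * T)) := partial_injection G /\ G `<=` A `*` B.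
have [||G [[Gpi GAB] _ Gmax]] := @Zorn_bigcup_above _ P set0.
- by split.
- move=> F _ FP totF; split.
    by apply: partial_injection_bigcup => // X /FP[].
  by move=> p [X /FP[_ XAB] /XAB].
have [domA|/existsNP[a /not_implyP[Aa na]]] :=
    pselect (forall a, A a -> exists b, G (a, b)).
  left; have /choice[h hG] : forall a, exists b, A a -> G (a, b).
    move=> a; by have [/domA[b]|] := pselect (A a); [exists b|exists a].
  exists h => [a /hG/GAB[]//|a b /set_mem/hG Ga /set_mem/hG Gb hab].
  exact/(Gpi _ _ Ga Gb).
have [ranB|/existsNP[b /not_implyP[Bb nb]]] :=
    pselect (forall b, B b -> exists a, G (a, b)).
  right; have /choice[h hG] : forall b, exists a, B b -> G (a, b).
    move=> b; by have [/ranB[a0]|] := pselect (B b); [exists a0|exists b].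
  exists h => [c /hG/GAB[]//|c d /set_mem/hG Gc /set_mem/hG Gd hcd].
  exact/(Gpi _ _ Gc Gd).
suff PG : P (G `|` [set (a, b)]).
  by case: na; exists b; apply: (Gmax _ _ PG); [left|right].
split; last by move=> p [/GAB//|->].
apply: partial_injectionU => // [p q -> -> //|[p1 p2] q Gp ->] /=.
by split=> e; [apply: na; exists p2; rewrite -e|apply: nb; exists p1; rewrite -e].
Qed.

(* A maximal subset [A] carrying an injection [A * A -> A] must be equipotent to
   the whole type: otherwise a disjoint copy of [A] could absorb the three new
   blocks of [(A + A) * (A + A)]. *)
Lemma infinite_pairing (T : Type) (iota : nat -> T) : injective iota ->
  exists p : T -> T -> T,
    forall x y x' y', p x y = p x' y' -> x = x' /\ y = y'.
Proof.
move=> iotaI.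
(* The current subset is read off the diagonal of [G]; [P G] makes [G] the graph of an injection
   from its square into it. *)
pose field (G : set ((T * T) * T)) : set T := [set x | exists z, G ((x, x), z)].
pose P (G : set ((T * T) * T)) := [/\ partial_injection G,
  (forall x y z, G ((x, y), z) -> [/\ field G x, field G y & field G z]) &
  (forall x y, field G x -> field G y -> exists z, G ((x, y), z))].
(* The seed pairs the range of [iota], whose elements later serve as tags inside [A]. *)
pose G0 : set ((T * T) * T) :=
  [set q | exists i j, q = ((iota i, iota j), iota (pickle (i, j)))].
have fieldG0 i : field G0 (iota i).
  by exists (iota (pickle (i, i))), i, i.
have [||G [[Gpi G1 G2] G0G Gmax]] := @Zorn_bigcup_above _ P G0.
- split.
  + move=> _ _ [i [j ->]] [i' [j' ->]] /=; split.
      by case=> /iotaI -> /iotaI ->.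
    by move=> /iotaI/(pcan_inj pickleK)[-> ->].
  + by move=> x y z [i [j [-> -> ->]]].
  + move=> x y [z [i [_ [-> _ _]]]] [z' [j [_ [-> _ _]]]].
    by exists (iota (pickle (i, j))), i, j.
- move=> F F0 FP totF; split.
  + by apply: partial_injection_bigcup => // X /FP[].
  + move=> x y z [X FX Xxyz]; have [_ X1 _] := FP _ FX.
    have [[a Xa] [b Xb] [c Xc]] := X1 _ _ _ Xxyz.
    by split; [exists a, X|exists b, X|exists c, X].
  + move=> x y [a [X FX Xa]] [b [Y FY Yb]].
    have [XY|YX] := totF _ _ FX FY.
      have [_ _ Y2] := FP _ FY.
      have [|z Yz] := Y2 x y _ (ex_intro _ b Yb); first by exists a; exact: XY.
      by exists z, Y.
    have [_ _ X2] := FP _ FX.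
    have [||z Xz] := X2 x y; [by exists a|by exists b; exact: YX|].
    by exists z, X.
pose A := field G.
have Ai i : A (iota i) by have [z] := fieldG0 i; exists z; exact: G0G.
have [f fG] : exists f : T -> T -> T,
    forall x y, A x -> A y -> G ((x, y), f x y).
  have /choice[f fG] : forall q, exists z, A q.1 -> A q.2 -> G (q, z).
    move=> [x y] /=.
    have [[Ax Ay]|nA] := pselect (A x /\ A y); last by exists x => ? ?; case: nA.
    by have [z] := G2 _ _ Ax Ay; exists z.
  by exists (fun x y => f (x, y)) => x y; exact: (fG (x, y)).
have fA x y : A x -> A y -> A (f x y).
  by move=> Ax Ay; have [] := G1 _ _ _ (fG _ _ Ax Ay).
have fI x y x' y' : A x -> A y -> A x' -> A y' ->
    f x y = f x' y' -> x = x' /\ y = y'.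
  move=> Ax Ay Ax' Ay' ff.
  by have /(_ ff)[] := (Gpi _ _ (fG _ _ Ax Ay) (fG _ _ Ax' Ay')).2.
have [[e eA eI]|[b bA bI]] := injection_comparable (~` A) A.
  (* The complement injects into [A], hence so does the whole type; the tags [iota 0] and [iota 1]
     keep the two pieces apart. *)
  pose j x := if `[< A x >] then f (iota 0) x else f (iota 1) (e x).
  have jA x : A (j x).
    by rewrite /j; case: asboolP => Ax; apply: (fA) => //; exact: eA.
  have jI : injective j.
    move=> x y; rewrite /j; case: asboolP => Ax; case: asboolP => Ay.
    - by move=> /fI[].
    - by move=> /fI[]//; [exact: eA|move=> /iotaI].
    - by move=> /fI[]//; [exact: eA|move=> /iotaI].
    - move=> /fI[]//; [exact: eA|exact: eA|move=> _].
      by apply: eI; exact: mem_set.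
  exists (fun x y => f (j x) (j y)) => x y x' y' /fI[]//.
  by move=> /jI -> /jI ->.
(* Now [b] embeds [A] into its complement, and [G] will be extended to the square of [A] enlarged by
   its image under [b]. *)
exfalso.
have bN x : A x -> ~ A (b x) by move=> /bA.
have bI' x y : A x -> A y -> b x = b y -> x = y.
  by move=> Ax Ay; apply: bI; exact: mem_set.
pose u (s : bool) x := if s then b x else x.
pose c (s t : bool) := iota (pickle (s, t)).
have cA s t : A (c s t) by exact: Ai.
have fcA s t x y : A x -> A y -> A (f (c s t) (f x y)).
  by move=> Ax Ay; apply: (fA) => //; exact: fA.
(* The condition [s || t] selects the three blocks outside the square of [A]; their tags [c s t]
   differ, so all fit injectively into the image of [b]. *)
pose H : set ((T * T) * T) := [set q | exists s t x y,
  [/\ s || t, A x, A y & q = ((u s x, u t y), b (f (c s t) (f x y)))]].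
have uI s s' x x' : A x -> A x' -> u s x = u s' x' -> s = s' /\ x = x'.
  move=> Ax Ax'; case: s; case: s' => //=.
  - by move=> /bI' ->.
  - by move=> bx; case: (bN _ Ax); rewrite bx.
  - by move=> bx; case: (bN _ Ax'); rewrite -bx.
have Hpi : partial_injection H.
  move=> _ _ [s [t [x [y [_ Ax Ay ->]]]]] [s' [t' [x' [y' [_ Ax' Ay' ->]]]]] /=.
  split.
    by case=> /uI[]// <- <- /uI[]// <- <-.
  move=> /(bI' _ _ (fcA s t x y Ax Ay) (fcA s' t' x' y' Ax' Ay')).
  move=> /(fI _ _ _ _ (cA s t) (fA _ _ Ax Ay) (cA s' t') (fA _ _ Ax' Ay'))[].
  by move=> /iotaI/(pcan_inj pickleK)[-> ->] /(fI _ _ _ _ Ax Ay Ax' Ay')[-> ->].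
have AH x : A x -> field (G `|` H) x by move=> [z Gz]; exists z; left.
have bH x : A x -> field (G `|` H) (b x).
  by move=> Ax; exists (b (f (c true true) (f x x))); right; exists true, true, x, x.
have uH s x : A x -> field (G `|` H) (u s x).
  by case: s => /=; [exact: bH|exact: AH].
have fieldGH x : field (G `|` H) x -> exists s a, A a /\ x = u s a.
  move=> [z [Gz|[s [t [a [a' [_ Aa _ [-> _ _]]]]]]]].
    by exists false, x; split=> //; exists z.
  by exists s, a.
have PGH : P (G `|` H).
  split.
  - apply: partial_injectionU => // -[[x y] z] q Gq [s [t [a [a' [st Aa Aa' ->]]]]] /=.
    have [Ax Ay Az] := G1 _ _ _ Gq; split.
      case=> xE yE; case: s t st xE yE => [] [] //= _ xE yE.
      + by apply: (bN a) => //; rewrite -xE.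
      + by apply: (bN a) => //; rewrite -xE.
      + by apply: (bN a') => //; rewrite -yE.
    by move=> zE; apply: (bN (f (c s t) (f a a'))); [apply: (fA) => //; exact: fA|rewrite -zE].
  - move=> x y z [/G1[Ax Ay Az]|[s [t [a [a' [st Aa Aa' [-> -> ->]]]]]]].
      by split; exact: AH.
    by split; [exact: uH|exact: uH|apply: bH; apply: (fA) => //; exact: fA].
  - move=> x y /fieldGH[s [a [Aa ->]]] /fieldGH[t [a' [Aa' ->]]].
    have [st|] := boolP (s || t).
      by exists (b (f (c s t) (f a a'))); right; exists s, t, a, a'.
    by case: s t => [] [] // _; exists (f a a'); left; exact: fG.
have [z Gz] := bH _ (Ai 0%N).
by apply: (bN _ (Ai 0%N)); exists z; apply: Gmax PGH _ Gz => ? ?; left.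
Qed.

(** * Dual space and Hahn-Banach *)

Section DualSpace.
Context {R : realType} {E : normedModType R}.
Implicit Types (x y z : E) (phi psi : @Dual R E).

Lemma dual_comb phi a x y :
  dual_app phi (a *: x + y) = a * dual_app phi x + dual_app phi y.
Proof. by case: phi => f [fL fC]; exact: fL. Qed.

Lemma dual_app0 phi : dual_app phi 0 = 0.
Proof.
have := dual_comb phi 1 0 0; rewrite scaler0 addr0 mul1r => e.
by apply: (@addrI _ (dual_app phi 0)); rewrite -e addr0.
Qed.

Lemma dual_appD phi x y : dual_app phi (x + y) = dual_app phi x + dual_app phi y.
Proof. by rewrite -{1}[x]scale1r dual_comb mul1r. Qed.

Lemma dual_appZ phi a x : dual_app phi (a *: x) = a * dual_app phi x.
Proof. by rewrite -[a *: x]addr0 dual_comb dual_app0 addr0. Qed.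

Lemma dual_appB phi x y : dual_app phi (x - y) = dual_app phi x - dual_app phi y.
Proof. by rewrite dual_appD -scaleN1r dual_appZ mulN1r. Qed.

Lemma dual_bounded phi :
  exists2 M : R, 0 < M & forall x, `|dual_app phi x| <= M * `|x|.
Proof.
have /= phiC := (proj2_sig phi).2 0.
have /cvgrPdist_lt/(_ 1 ltr01)/nbhs_ballP[d /= d0 dP] := phiC.
exists (2 / d) => [|x]; first by rewrite divr_gt0.
have [->|x0] := eqVneq x 0; first by rewrite dual_app0 !normr0 mulr0.
have nx0 : 0 < `|x| by rewrite normr_gt0.
have := dP ((d / 2 / `|x|) *: x).
rewrite -ball_normE /ball_ /= sub0r normrN normrZ ger0_norm; last first.
  by rewrite !divr_ge0// ltW.
rewrite divfK ?gt_eqF// -/(dual_app phi _) -/(dual_app phi _).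
rewrite dual_app0 sub0r normrN dual_appZ normrM ger0_norm; last first.
  by rewrite !divr_ge0// ltW.
have dE : d / 2 < d by lra.
move=> /(_ dE)/ltW; rewrite mulrAC ler_pdivrMr// mul1r => h.
by rewrite -ler_pdivrMl ?divr_gt0// invf_div.
Qed.

Lemma linfun_bounded_continuous (f : E -> R) (M : R) :
  is_linfun f -> (forall x, `|f x| <= M * `|x|) -> continuous f.
Proof.
move=> fL fM x.
have fB u v : f u - f v = f (u - v).
  by rewrite [u - v]addrC -[- v]scaleN1r fL mulN1r addrC.
apply/cvgrPdist_lt => e e0; near=> y.
rewrite fB; apply: le_lt_trans (fM _) _.
have M0 : 0 < `|M| + 1 by rewrite ltr_wpDl.
apply: (@le_lt_trans _ _ ((`|M| + 1) * `|x - y|)).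
  by rewrite ler_wpM2r// (le_trans (ler_norm _))// lerDl.
rewrite -ltr_pdivlMl// mulrC.
near: y; apply: cvgr_dist_lt; [exact: cvg_id|by rewrite divr_gt0].
Unshelve. all: by end_near. Qed.

(** Source of the rescaled and perturbed functionals below, [Dual] being a bare subtype. *)
Lemma dual_linear_combination a b phi psi :
  exists chi : @Dual R E,
    forall x, dual_app chi x = a * dual_app phi x + b * dual_app psi x.
Proof.
have [M M0 phiM] := dual_bounded phi; have [N N0 psiN] := dual_bounded psi.
pose f x := a * dual_app phi x + b * dual_app psi x.
have fL : is_linfun f by move=> c x y; rewrite /f !dual_comb; ring.
have fC : continuous f.
  apply: (@linfun_bounded_continuous f (`|a| * M + `|b| * N)) => // x.
  apply: le_trans (ler_normD _ _) _; rewrite !normrM mulrDl -!mulrA.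
  by apply: lerD; apply: ler_wpM2l.
by exists (exist _ f (conj fL fC)).
Qed.

End DualSpace.

(* Since the graph is a linear subspace, the bound at [0] alone makes it
   functional. *)
Definition dominated_graph (R : realType) (E : normedModType R) (G : set (E * R)) :=
  (forall a p q, G p -> G q -> G (a *: p.1 + q.1, a * p.2 + q.2)) /\
  (forall p, G p -> p.2 <= `|p.1|).

(** One-step Hahn-Banach extension. The value at [x0] must lie above every p.2 - |p.1 - x0| and
    below every |p.1 + x0| - p.2; domination on [G] makes these bounds compatible, and the supremum
    of the lower ones is taken. *)
Lemma dominated_graph_extend (R : realType) (E : normedModType R)
    (G : set (E * R)) (x0 : E) : dominated_graph G -> G !=set0 ->
  exists H, [/\ dominated_graph H, G `<=` H & exists c, H (x0, c)].
Proof.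
move=> [GL Gle] [q0 Gq0].
have G00 : G (0, 0).
  by have := GL (-1) _ _ Gq0 Gq0; rewrite scaleN1r mulN1r !addNr.
have GZ a p : G p -> G (a *: p.1, a * p.2).
  by move=> Gp; have := GL a _ _ Gp G00; rewrite /= !addr0.
pose S := [set p.2 - `|p.1 - x0| | p in G].
have Sub p : G p -> ubound S (`|p.1 + x0| - p.2).
  move=> Gp _ [q Gq <-]; rewrite lerBrDr addrAC lerBlDr.
  have := Gle _ (GL 1 _ _ Gq Gp); rewrite /= scale1r mul1r => /le_trans; apply.
  rewrite [leRHS]addrC; apply: le_trans (ler_normD _ _).
  by rewrite addrACA addNr addr0.
have S0 : S !=set0 by exists (0 - `|0 - x0|), (0, 0).
have cle p : G p -> sup S <= `|p.1 + x0| - p.2 by move=> /Sub; exact: ge_sup.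
have lec p : G p -> p.2 - `|p.1 - x0| <= sup S.
  move=> Gp; apply: ub_le_sup; last by exists p.
  by exists (`|0 + x0| - 0); exact: (Sub (0, 0)).
pose H : set (E * R) :=
  [set q | exists p t, G p /\ q = (p.1 + t *: x0, p.2 + t * sup S)].
exists H; split.
- split.
    move=> a _ _ [p [s [Gp ->]]] [q [t [Gq ->]]] /=.
    exists (a *: p.1 + q.1, a * p.2 + q.2), (a * s + t); split; first exact: GL.
    by rewrite /= scalerDr scalerDl scalerA addrACA; congr pair; ring.
  move=> _ [p [t [Gp ->]]] /=.
  (* After division by |t|, negative [t] uses the lower bound [lec] on the new value and positive
     [t] the upper bound [cle]. *)
  have [t0|t0|->] := ltgtP t 0; last by rewrite scale0r mul0r !addr0; exact: Gle.
    have s0 : 0 < - t by rewrite oppr_gt0.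
    have -> : p.1 + t *: x0 = (- t) *: ((- t)^-1 *: p.1 - x0).
      by rewrite scalerBr scalerA divff ?gt_eqF// scale1r scaleNr opprK.
    rewrite normrZ gtr0_norm//.
    have := lec _ (GZ (- t)^-1 _ Gp).
    rewrite /= lerBlDr -lerBlDl -(ler_pM2l s0) mulrBr mulrA divff ?gt_eqF//.
    by rewrite mul1r mulNr opprK.
  have -> : p.1 + t *: x0 = t *: (t^-1 *: p.1 + x0).
    by rewrite scalerDr scalerA divff ?gt_eqF// scale1r.
  rewrite normrZ gtr0_norm//.
  have := cle _ (GZ t^-1 _ Gp).
  rewrite /= lerBrDr -(ler_pM2l t0) mulrDr mulrA divff ?gt_eqF//.
  by rewrite mul1r addrC.
- by move=> [x r] Gp; exists (x, r), 0; rewrite /= scale0r mul0r !addr0.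
- exists (sup S), (0, 0), 1; split=> //.
  by rewrite /= !add0r scale1r mul1r.
Qed.

(** Zorn's lemma is seeded with the line through [z]; a maximal dominated graph is total by the
    one-step extension. *)
Lemma norming_functional (R : realType) (E : normedModType R) (z : E) :
  exists2 psi : @Dual R E,
    forall x, `|dual_app psi x| <= `|x| & dual_app psi z = `|z|.
Proof.
pose G0 : set (E * R) := [set p | exists t, p = (t *: z, t * `|z|)].
have [||G [domG G0G Gmax]] := @Zorn_bigcup_above _ (@dominated_graph R E) G0.
- split=> [a _ _ [s ->] [t ->]|_ [t ->]] /=.
    by exists (a * s + t); rewrite scalerDl scalerA mulrDl mulrA.
  by rewrite normrZ ler_wpM2r// ler_norm.
- move=> F _ FP totF; split=> [a p q [X FX Xp] [Y FY Yq]|p [X FX Xp]].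
    have [XY|YX] := totF _ _ FX FY.
      by exists Y => //; apply: (FP _ FY).1 => //; exact: XY.
    by exists X => //; apply: (FP _ FX).1 => //; exact: YX.
  exact: (FP _ FX).2.
have G0n : G0 (0, 0) by exists 0; rewrite scale0r mul0r.
have [f fG] : exists f, forall x, G (x, f x).
  have /choice[f fG] : forall x, exists c, G (x, c); last by exists f.
  move=> x; have [|H [domH GH [c Hc]]] := dominated_graph_extend x domG.
    by exists (0, 0); exact: G0G.
  by exists c; exact: (Gmax _ GH domH).
have [GL Gle] := domG.
have Guniq x r s : G (x, r) -> G (x, s) -> r = s.
  move=> Gr Gs; apply/eqP; rewrite eq_le.
  have := Gle _ (GL (-1) _ _ Gr Gs); have := Gle _ (GL (-1) _ _ Gs Gr).
  by rewrite /= !scaleN1r !mulN1r !addNr normr0 !(addrC (- _)) !subr_le0 => -> ->.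
have fL : is_linfun f.
  by move=> a x y; apply: (Guniq _ _ _ (fG _)); exact: (GL a _ _ (fG x) (fG y)).
have fle x : `|f x| <= `|x|.
  rewrite ler_norml (Gle _ (fG x)) andbT lerNl.
  have := Gle _ (GL (-1) _ _ (fG x) (G0G _ G0n)).
  by rewrite /= !addr0 scaleN1r mulN1r normrN.
have fC : continuous f.
  by apply: (@linfun_bounded_continuous _ _ f 1) => // x; rewrite mul1r.
exists (exist _ f (conj fL fC)) => //.
apply: (Guniq _ _ _ (fG z)); apply: G0G.
by exists 1; rewrite scale1r mul1r.
Qed.

(** * The FBL norm *)

Lemma ler_dist_max (R : realDomainType) (a b c d : R) :
  `|Num.max a b - Num.max c d| <= `|a - c| + `|b - d|.
Proof.
have := ler_norm (a - c); have := ler_norm (b - d).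
have := ler_norm (- (a - c)); have := ler_norm (- (b - d)).
have := normr_ge0 (a - c); have := normr_ge0 (b - d).
rewrite !normrN ler_norml => *.
by apply/andP; split; case: (leP a b); case: (leP c d); lra.
Qed.

Section FBLNorm.
Context {R : realType} {E : normedModType R}.
Implicit Types (x y z : E) (phi psi : @Dual R E) (f g h k s : @Dual R E -> R).

(** Real upper bounds for the norm, so that the estimates avoid extended reals. *)
Definition fbl_le f (c : R) := forall n (xs : 'I_n -> @Dual R E),
  admissible xs -> \sum_(i < n) `|f (xs i)| <= c.

Lemma fbl_norm_leP f c : (fbl_norm f <= c%:E)%E <-> fbl_le f c.
Proof.
split=> [fc n xs axs|fc].
  by rewrite -lee_fin; apply: le_trans fc; apply: ereal_sup_ubound; exists n, xs.
by apply: ge_ereal_sup => _ [n [xs [axs ->]]]; rewrite lee_fin; exact: fc.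
Qed.

Lemma fbl_norm_lt_le f c : (fbl_norm f < c%:E)%E -> fbl_le f c.
Proof. by move=> /ltW/fbl_norm_leP. Qed.

Lemma fbl_le_norm_lt f c d : fbl_le f c -> c < d -> (fbl_norm f < d%:E)%E.
Proof. by move=> /fbl_norm_leP fc cd; apply: le_lt_trans fc _; rewrite lte_fin. Qed.

Lemma H0P f : H0 f <-> pos_homogeneous f /\ exists c, fbl_le f c.
Proof.
split=> [[fH foo]|[fH [c /fbl_norm_leP fc]]].
  split=> //; case E0: (fbl_norm f) foo => [r| |] // _.
    by exists r; apply/fbl_norm_leP; rewrite E0.
  by exists 0; apply/fbl_norm_leP; rewrite E0 leNye.
by split=> //; apply: le_lt_trans fc _; exact: ltry.
Qed.

Lemma fbl_le_comb f h k (a b c d : R) : 0 <= a -> 0 <= b ->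
  (forall phi, `|f phi| <= a * `|h phi| + b * `|k phi|) ->
  fbl_le h c -> fbl_le k d -> fbl_le f (a * c + b * d).
Proof.
move=> a0 b0 fhk hc kd n xs axs.
apply: (@le_trans _ _ (\sum_(i < n) (a * `|h (xs i)| + b * `|k (xs i)|))).
  by apply: ler_sum => i _.
rewrite big_split /= -!mulr_sumr.
by apply: lerD; apply: ler_wpM2l => //; [exact: hc|exact: kd].
Qed.

Lemma fbl_leZ f h (a c : R) : 0 <= a ->
  (forall phi, `|f phi| <= a * `|h phi|) -> fbl_le h c -> fbl_le f (a * c).
Proof.
move=> a0 fh hc; rewrite -[a * c]addr0 -[0](mul0r c).
by apply: fbl_le_comb (hc) (hc) => // phi; rewrite mul0r addr0.
Qed.

Lemma fbl_le_mono f h (c : R) :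
  (forall phi, `|f phi| <= `|h phi|) -> fbl_le h c -> fbl_le f c.
Proof.
by move=> fh hc; rewrite -[c]mul1r; apply: fbl_leZ hc => // phi; rewrite mul1r.
Qed.

Lemma fbl_leD f h k (c d : R) :
  (forall phi, `|f phi| <= `|h phi| + `|k phi|) ->
  fbl_le h c -> fbl_le k d -> fbl_le f (c + d).
Proof.
move=> fhk hc kd; rewrite -[c]mul1r -[d]mul1r.
by apply: fbl_le_comb hc kd => // phi; rewrite !mul1r.
Qed.

Lemma fbl_le_weaken f (c d : R) : c <= d -> fbl_le f c -> fbl_le f d.
Proof. by move=> cd fc n xs /fc/le_trans; apply. Qed.

Lemma fbl_le_delta x : fbl_le (delta x) `|x|.
Proof.
move=> n xs axs; have [->|x0] := eqVneq x 0.
  by rewrite normr0 big1// => i _; rewrite /delta dual_app0 normr0.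
have nx0 : 0 < `|x| by rewrite normr_gt0.
have := axs (`|x|^-1 *: x); rewrite normrZ normfV normr_id mulVf ?gt_eqF//.
move=> /(_ (lexx _)) h; rewrite -[leRHS]mulr1 -ler_pdivrMl//.
apply: le_trans h; rewrite mulr_sumr; apply: ler_sum => i _.
by rewrite dual_appZ normrM normfV normr_id.
Qed.

(** Divided by [M], the functional [phi] alone forms an admissible family. Hence norm convergence in
    [H0] is uniform on bounded sets of functionals. *)
Lemma fbl_le_eval h (c M : R) phi : 0 < M -> pos_homogeneous h -> fbl_le h c ->
  (forall x, `|dual_app phi x| <= M * `|x|) -> `|h phi| <= M * c.
Proof.
move=> M0 hH hc phiM.
have [chi chiE] := dual_linear_combination M^-1 0 phi phi.
have := hc 1%N (fun=> chi); rewrite big_ord1 => h1.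
rewrite -ler_pdivrMl//.
have -> : M^-1 * `|h phi| = `|h chi|.
  rewrite (hH M^-1 phi chi) ?invr_gt0// => [|x].
    by rewrite normrM gtr0_norm// invr_gt0.
  by rewrite chiE mul0r addr0.
apply: h1 => x x1; rewrite big_ord1 chiE mul0r addr0 normrM gtr0_norm ?invr_gt0//.
rewrite ler_pdivrMl// mulr1; apply: le_trans (phiM _) _.
by rewrite -[leRHS]mulr1 ler_wpM2l// ltW.
Qed.

Lemma H0_delta x : H0 (delta x).
Proof.
apply/H0P; split=> [a phi psi _|]; first exact.
by exists `|x|; exact: fbl_le_delta.
Qed.

Lemma H0D f g : H0 f -> H0 g -> H0 (f \+ g).
Proof.
move=> /H0P[fH [c fc]] /H0P[gH [d gd]]; apply/H0P; split.
  by move=> a phi psi a0 e /=; rewrite (fH a phi)// (gH a phi)// mulrDr.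
by exists (c + d); apply: fbl_leD fc gd => phi; exact: ler_normD.
Qed.

Lemma H0Z (a : R) f : H0 f -> H0 (fun phi => a * f phi).
Proof.
move=> /H0P[fH [c fc]]; apply/H0P; split.
  by move=> b phi psi b0 e /=; rewrite (fH b phi)// mulrCA.
by exists (`|a| * c); apply: fbl_leZ fc => // phi; rewrite normrM.
Qed.

Lemma H0B f g : H0 f -> H0 g -> H0 (f \- g).
Proof.
move=> Hf /(H0Z (-1)) Hg; have := H0D Hf Hg; congr H0.
by apply: funext => phi /=; rewrite mulN1r.
Qed.

Lemma H0_max f g : H0 f -> H0 g -> H0 (fun phi => Num.max (f phi) (g phi)).
Proof.
move=> /H0P[fH [c fc]] /H0P[gH [d gd]]; apply/H0P; split.
  by move=> a phi psi a0 e /=; rewrite (fH a phi)// (gH a phi)// maxr_pMr// ltW.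
exists (c + d); apply: fbl_leD fc gd => phi.
by rewrite -[Num.max _ _]subr0 -{1}(maxxx 0) (le_trans (ler_dist_max _ _ _ _))// !subr0.
Qed.

Lemma min_as_max f g : (fun phi => Num.min (f phi) (g phi)) =
  (fun phi => -1 * Num.max (-1 * f phi) (-1 * g phi)).
Proof. by apply: funext => phi; rewrite !mulN1r -oppr_min opprK. Qed.

Lemma H0_min f g : H0 f -> H0 g -> H0 (fun phi => Num.min (f phi) (g phi)).
Proof.
by move=> Hf Hg; rewrite min_as_max; apply/H0Z/H0_max; exact: H0Z.
Qed.

(** The functions of [H0] satisfying [P] form one of the closed sublattices that [FBL] intersects;
    minima reduce to maxima and scaling by -1. *)
Lemma FBL_ind (P : set (@Dual R E -> R)) :
  (forall x, P (delta x)) ->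
  (forall f g, H0 f -> H0 g -> P f -> P g -> P (f \+ g)) ->
  (forall (a : R) f, H0 f -> P f -> P (fun phi => a * f phi)) ->
  (forall f g, H0 f -> H0 g -> P f -> P g ->
    P (fun phi => Num.max (f phi) (g phi))) ->
  (forall h, H0 h ->
    (forall e : R, 0 < e -> exists s, [/\ H0 s, P s & fbl_le (h \- s) e]) ->
    P h) ->
  FBL `<=` H0 `&` P.
Proof.
move=> Pdelta PD PZ Pmax Plim f; apply; split; first by move=> ? [].
split; first by move=> x; split=> //; exact: H0_delta.
split; first by move=> ? ? [? ?] [? ?]; split; [exact: H0D|exact: PD].
split; first by move=> ? ? [? ?]; split; [exact: H0Z|exact: PZ].
split; first by move=> ? ? [? ?] [? ?]; split; [exact: H0_max|exact: Pmax].
split.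
  move=> g h [Hg Pg] [Hh Ph]; split; first exact: H0_min.
  have HN k : H0 k -> H0 (fun phi => -1 * k phi) := @H0Z (-1) k.
  rewrite min_as_max; apply: (PZ (-1)); first exact: (H0_max (HN _ Hg) (HN _ Hh)).
  exact: (Pmax _ _ (HN _ Hg) (HN _ Hh) (PZ _ _ Hg Pg) (PZ _ _ Hh Ph)).
move=> h Hh hlim; split=> //; apply: Plim => // e e0.
by have [s [Hs Ps] hs] := hlim _ e0; exists s; split=> //; exact: fbl_norm_lt_le.
Qed.

Lemma FBL_H0 f : FBL f -> H0 f.
Proof. by move=> /(@FBL_ind setT)[]. Qed.

Lemma FBL_delta x : FBL (delta x).
Proof. by move=> S [_ []]. Qed.

Lemma FBLD f g : FBL f -> FBL g -> FBL (f \+ g).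
Proof.
by move=> Ff Fg S SS; have [_ [_ [+ _]]] := SS; apply; [exact: (Ff _ SS)|exact: (Fg _ SS)].
Qed.

Lemma FBLZ (a : R) f : FBL f -> FBL (fun phi => a * f phi).
Proof. by move=> Ff S SS; have [_ [_ [_ [+ _]]]] := SS; apply; exact: (Ff _ SS). Qed.

Lemma FBL_max f g : FBL f -> FBL g -> FBL (fun phi => Num.max (f phi) (g phi)).
Proof.
move=> Ff Fg S SS; have [_ [_ [_ [_ [+ _]]]]] := SS.
by apply; [exact: (Ff _ SS)|exact: (Fg _ SS)].
Qed.

Lemma FBL_min f g : FBL f -> FBL g -> FBL (fun phi => Num.min (f phi) (g phi)).
Proof. by move=> Ff Fg; rewrite min_as_max; apply: (@FBLZ (-1)); apply: FBL_max; exact: (@FBLZ (-1)). Qed.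

(** Continuity for the operator norm. It holds for each [delta x], passes through the lattice
    operations, and survives limits because these are locally uniform by [fbl_le_eval]. *)
Lemma FBL_continuous f phi0 : FBL f -> forall e : R, 0 < e ->
  exists2 r : R, 0 < r & forall phi,
    (forall x, `|dual_app phi x - dual_app phi0 x| <= r * `|x|) ->
    `|f phi - f phi0| <= e.
Proof.
pose P : set (@Dual R E -> R) := [set f | forall e : R, 0 < e ->
  exists2 r : R, 0 < r & forall phi,
    (forall x, `|dual_app phi x - dual_app phi0 x| <= r * `|x|) ->
    `|f phi - f phi0| <= e].
suff /[apply] -[] : FBL `<=` H0 `&` P by [].
have [M M0 phi0M] := dual_bounded phi0.
have P2 g h k : P g -> P h ->
    (forall phi psi, `|k phi - k psi| <= `|g phi - g psi| + `|h phi - h psi|) ->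
    P k.
  move=> Pg Ph ghk e e0; have e20 : 0 < e / 2 by lra.
  have [r r0 rP] := Pg _ e20; have [s s0 sP] := Ph _ e20.
  exists (Num.min r s); first by rewrite lt_min r0.
  move=> phi hphi; apply: le_trans (ghk _ _) _.
  rewrite [leRHS](splitr e); apply: lerD; [apply: rP|apply: sP] => x;
    by rewrite (le_trans (hphi x))// ler_wpM2r// ge_min lexx ?orbT.
apply: FBL_ind.
- move=> x e e0; have x0 : 0 < `|x| + 1 by rewrite ltr_wpDl.
  exists (e / (`|x| + 1)) => [|phi /(_ x)]; first by rewrite divr_gt0.
  move=> /le_trans; apply.
  by rewrite mulrAC ler_pdivrMr// ler_wpM2l ?(ltW e0)// lerDl.
- move=> g h _ _ Pg Ph; apply: P2 Pg Ph _ => phi psi.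
  by rewrite /= opprD addrACA ler_normD.
- move=> a g _ Pg e e0; have a0 : 0 < `|a| + 1 by rewrite ltr_wpDl.
  have [|r r0 rP] := Pg (e / (`|a| + 1)); first by rewrite divr_gt0.
  exists r => // phi /rP h; rewrite -mulrBr normrM.
  apply: (@le_trans _ _ ((`|a| + 1) * `|g phi - g phi0|)).
    by rewrite ler_wpM2r// lerDl.
  by rewrite -ler_pdivlMl// mulrC.
- by move=> g h _ _ Pg Ph; apply: P2 Pg Ph _ => phi psi; exact: ler_dist_max.
- move=> h Hh hlim e e0; have M1 : 0 < M + 1 by lra.
  have e3 : 0 < e / 3 by lra.
  (* On functionals of norm at most [M + 1] this tolerance becomes [e / 3]; capping the radius at 1
     below keeps [phi] among them. *)
  have [|s [Hs Ps hs]] := hlim (e / 3 / (M + 1)); first by rewrite divr_gt0.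
  have [r r0 rP] := Ps _ e3.
  have [hsH _] := H0B Hh Hs.
  have near phi : (forall x, `|dual_app phi x| <= (M + 1) * `|x|) ->
      `|h phi - s phi| <= e / 3.
    by move=> /(fbl_le_eval M1 hsH hs); rewrite [leRHS]mulrC divfK ?gt_eqF.
  exists (Num.min r 1) => [|phi hphi]; first by rewrite lt_min r0 ltr01.
  have /near h1 x : `|dual_app phi x| <= (M + 1) * `|x|.
    rewrite -[dual_app phi x](subrK (dual_app phi0 x)) addrC mulrDl.
    apply: le_trans (ler_normD _ _) _; apply: lerD => //.
    by apply: le_trans (hphi x) _; rewrite ler_wpM2r// ge_min lexx orbT.
  have /near h0 x : `|dual_app phi0 x| <= (M + 1) * `|x|.
    by rewrite (le_trans (phi0M x))// ler_wpM2r// lerDl.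
  have /rP hr x : `|dual_app phi x - dual_app phi0 x| <= r * `|x|.
    by apply: le_trans (hphi x) _; rewrite ler_wpM2r// ge_min lexx.
  have -> : h phi - h phi0 = (h phi - s phi) + (s phi - s phi0) - (h phi0 - s phi0).
    by ring.
  apply: le_trans (ler_normB _ _) _.
  have := ler_normD (h phi - s phi) (s phi - s phi0); lra.
Qed.

Definition clip f g h : @Dual R E -> R :=
  fun phi => Num.min (Num.max (h phi) (f phi)) (g phi).

Lemma clip_order_interval f g h : FBL f -> FBL g -> (forall phi, f phi <= g phi) ->
  FBL h -> order_interval f g (clip f g h).
Proof.
move=> Ff Fg fg Fh; split.
  by apply: FBL_min Fg; exact: FBL_max.
by split=> phi; rewrite /clip ?le_min ?ge_min ?le_max ?lexx ?orbT ?fg.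
Qed.

Lemma clip_id f g h phi : f phi <= h phi -> h phi <= g phi ->
  clip f g h phi = h phi.
Proof. by move=> fh hg; rewrite /clip (max_idPl fh) (min_idPl hg). Qed.

(** With [fbl_le_mono], this makes clipping a contraction for the norm. *)
Lemma clip_dist f g h k phi :
  `|clip f g h phi - clip f g k phi| <= `|h phi - k phi|.
Proof.
rewrite /clip; have := ler_norm (h phi - k phi); have := ler_norm (- (h phi - k phi)).
rewrite normrN ler_norml; move: (f phi) (g phi) (h phi) (k phi) `|_| => a b c d n.
move=> h1 h2; have n0 : 0 <= n by lra.
by case: (leP c a) => ca; case: (leP d a) => da;
  case: (leP a b) => ab; case: (leP c b) => cb; case: (leP d b) => db;
  apply/andP; split; lra.
Qed.

End FBLNorm.

(** * Lattice terms *)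

(** Rational coefficients keep the terms as few as the elements of an infinite [X]; minima arise
    from [Max] and scaling by -1. *)
Inductive lattice_term (X : Type) : Type :=
| Var of X
| Add of lattice_term X & lattice_term X
| Scale of rat & lattice_term X
| Max of lattice_term X & lattice_term X.

(** Each constructor has its own tag, paired with the recursive codes of its arguments; rationals
    are coded by [pickle]. *)
Lemma lattice_term_injection (X : Type) (iota : nat -> X) : injective iota ->
  exists c : lattice_term X -> X, injective c.
Proof.
move=> iotaI; have [p pI] := infinite_pairing iotaI.
pose fix c (t : lattice_term X) : X := match t with
  | Var x => p (iota 0) x
  | Add s t => p (iota 1) (p (c s) (c t))
  | Scale q t => p (iota 2) (p (iota (pickle q)) (c t))
  | Max s t => p (iota 3) (p (c s) (c t)) end.
exists c; elim=> [x|s IHs t IHt|q t IHt|s IHs t IHt] [y|s' t'|q' t'|s' t'] /=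
  /pI[] // /iotaI // _.
- by move=> ->.
- by move=> /pI[/IHs -> /IHt ->].
- by move=> /pI[/iotaI/(pcan_inj pickleK) -> /IHt ->].
- by move=> /pI[/IHs -> /IHt ->].
Qed.

Section TermEvaluation.
Context {R : realType} {E : normedModType R} {X : Type} (v : X -> E).

Fixpoint term_eval (t : lattice_term X) : @Dual R E -> R := match t with
  | Var x => delta (v x)
  | Add s t => term_eval s \+ term_eval t
  | Scale q t => fun phi => ratr q * term_eval t phi
  | Max s t => fun phi => Num.max (term_eval s phi) (term_eval t phi) end.

Lemma FBL_term_eval (t : lattice_term X) : FBL (term_eval t).
Proof.
elim: t => [x|s Fs t Ft|q t Ft|s Fs t Ft] /=.
- exact: FBL_delta.
- exact: FBLD.
- exact: FBLZ.
- exact: FBL_max.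
Qed.

Lemma term_eval_dense :
  (forall x e, 0 < e -> exists i, `|x - v i| < e) ->
  forall f, FBL f -> forall e : R, 0 < e ->
    exists t, fbl_le (f \- term_eval t) e.
Proof.
move=> vdense.
pose P : set (@Dual R E -> R) := [set f | forall e : R, 0 < e ->
  exists t, fbl_le (f \- term_eval t) e].
suff FP : FBL `<=` H0 `&` P by move=> f /FP[].
apply: FBL_ind.
- move=> x e e0; have [i xi] := vdense x _ e0; exists (Var i).
  apply: (fbl_le_weaken (ltW xi)); apply: fbl_le_mono (fbl_le_delta (x - v i)).
  by move=> phi; rewrite /= /delta dual_appB.
- move=> f g _ _ Pf Pg e e0; have e20 : 0 < e / 2 by lra.
  have [s fs] := Pf _ e20; have [t gt] := Pg _ e20; exists (Add s t).
  rewrite [e]splitr; apply: fbl_leD fs gt => phi /=.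
  by rewrite opprD addrACA ler_normD.
- move=> a f Hf Pf e e0.
  have [_ [c fc]] := (H0P f).1 Hf.
  have c0 : 0 < `|c| + 1 by rewrite ltr_wpDl.
  (* The rational [q] within [d] of [a] is chosen before [t], whose tolerance depends on [q]; each
     replacement costs at most [e / 2]. *)
  pose d := e / 2 / (`|c| + 1).
  have d0 : 0 < d by rewrite !divr_gt0.
  have [|q] := @rat_in_itvoo R (a - d) (a + d); first by lra.
  rewrite in_itv /= => /andP[q1 q2].
  have q0 : 0 < `|ratr q : R| + 1 by rewrite ltr_wpDl.
  have [|t ft] := Pf (e / 2 / (`|ratr q : R| + 1)); first by rewrite !divr_gt0.
  exists (Scale q t).
  have eE : d * (`|c| + 1) +
      (`|ratr q : R| + 1) * (e / 2 / (`|ratr q : R| + 1)) = e.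
    by rewrite /d divfK ?gt_eqF// [X in _ + X]mulrC divfK ?gt_eqF// -splitr.
  rewrite -eE; apply: fbl_le_comb (ltW d0) (ltW q0) _ _ ft => [phi|]; last first.
    by apply: fbl_le_weaken fc; rewrite (le_trans (ler_norm _))// lerDl.
  rewrite /= (_ : a * _ - _ =
    (a - ratr q) * f phi + ratr q * (f phi - term_eval t phi)); last by ring.
  apply: le_trans (ler_normD _ _) _; rewrite !normrM.
  apply: lerD; apply: ler_wpM2r => //; last by rewrite lerDl.
  by rewrite ler_norml; apply/andP; split; lra.
- move=> f g _ _ Pf Pg e e0; have e20 : 0 < e / 2 by lra.
  have [s fs] := Pf _ e20; have [t gt] := Pg _ e20; exists (Max s t).
  by rewrite [e]splitr; apply: fbl_leD fs gt => phi; exact: ler_dist_max.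
- move=> h _ hlim e e0; have e20 : 0 < e / 2 by lra.
  have [s [_ Ps hs]] := hlim _ e20; have [t st] := Ps _ e20; exists t.
  rewrite [e]splitr; apply: fbl_leD hs st => phi /=.
  by rewrite -[h phi](subrK (s phi)) -[_ - s phi + _ - _]addrA addrK ler_normD.
Qed.

End TermEvaluation.

(** * Cardinality of ranges and of dense sets *)

Lemma infinite_injection (T : Type) (D : set T) : infinite_set D ->
  exists iota : nat -> D, injective iota.
Proof.
move=> /infiniteP/card_leP[i].
exists (fun n => i (SigSub (mem_setT n))) => m n imn.
by have /(congr1 val) := 'inj_i (mem_setT _) (mem_setT _) imn.
Qed.

Lemma injection_range_card (T U V : Type) (D : set T) (c : U -> D) (h : U -> V) :
  injective c -> (range h #<= D)%card.
Proof.
move=> cI; apply: card_le_trans (card_image_le h setT) _.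
apply: (@card_le_trans _ _ _ [set: D]); last first.
  by rewrite (card_le_eql (card_setT D)) card_lexx.
have [i] : $|{injfun [set: U] >-> [set: D]}|.
  by apply/injfunPex; exists c => // x y _ _ /cI.
exact: inj_card_le i.
Qed.

(** Finitely many values of [v] would miss a nondegenerate closed subinterval, whose midpoint could
    then not be approximated. *)
Lemma dense_itv_infinite (R : realType) (T : Type) (D : set T) (v : T -> R) (a b : R) :
  a < b ->
  (forall s e, a <= s <= b -> 0 < e -> exists2 d, D d & `|s - v d| < e) ->
  infinite_set D.
Proof.
move=> ab vD /(finite_image v)/finite_seqP[s sE].
suff [c [d [ac cd db cds]]] : exists c d, [/\ a <= c, c < d, d <= b &
    forall x, x \in s -> ~~ (c <= x <= d)].
  have e0 : 0 < (d - c) / 2 by lra.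
  have [|t Dt] := vD ((c + d) / 2) _ _ e0; first by apply/andP; split; lra.
  have : v t \in s by have : (v @` D) (v t) by [exists t]; rewrite sE.
  move=> /cds/negP vts; rewrite ltr_norml => /andP[h1 h2].
  by apply: vts; apply/andP; split; lra.
elim: s {sE} => [|x s [c [d [ac cd db cds]]]]; first by exists a, b; split.
have [xc|xc] := ltP x ((c + d) / 2).
  exists ((c + d) / 2), d; split=> //; [lra|lra|move=> y].
  rewrite inE => /predU1P[->|/cds]; first by rewrite leNgt xc.
  by apply: contra => /andP[h1 h2]; apply/andP; split; lra.
(* Here [x] may be the midpoint itself, so the closed interval kept is only the left quarter. *)
exists c, ((3 * c + d) / 4); split=> //; [lra|lra|move=> y].
rewrite inE => /predU1P[->|/cds]; first by apply/negP => /andP[h1 h2]; lra.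
by apply: contra => /andP[h1 h2]; apply/andP; split; lra.
Qed.

(** * Order intervals *)

Section OrderInterval.
Context {R : realType} {E : normedModType R} (f g : @Dual R E -> R).
Hypotheses (Ff : FBL f) (Fg : FBL g) (fg : forall phi, f phi <= g phi).

(** A positively homogeneous function vanishes at the zero functional, where its value equals its
    own double; so [phi0] cannot be zero. *)
Lemma dual_neq0 (phi0 : @Dual R E) :
  f phi0 < g phi0 -> exists y, dual_app phi0 y != 0.
Proof.
move=> fg0; apply: contrapT => h.
have phi00 x : dual_app phi0 x = 0.
  by apply/eqP/negPn/negP => nz; apply: h; exists x.
have hom0 k : pos_homogeneous k -> k phi0 = 0.
  move=> kH; have : k phi0 = 2 * k phi0; last lra.
  by apply: kH => // x; rewrite phi00 mulr0.
have [fH _] := FBL_H0 Ff; have [gH _] := FBL_H0 Fg.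
by move: fg0; rewrite !hom0// ltxx.
Qed.

(* On a norm ball around [phi0] the clipping at [f] and [g] does not affect
   [delta (y + x)] for small [x], and such a ball norms [E]. *)
Lemma local_embedding (phi0 : @Dual R E) : f phi0 < g phi0 ->
  exists rho C : R, exists h : E -> @Dual R E -> R, [/\ 0 < rho, 0 < C,
    forall x, order_interval f g (h x) &
    forall x x' c, `|x| <= rho -> `|x'| <= rho -> fbl_le (h x \- h x') c ->
      `|x - x'| <= C * c].
Proof.
move=> fg0; have [y0 y00] := dual_neq0 fg0.
have [M M0 phi0M] := dual_bounded phi0.
pose y := ((f phi0 + g phi0) / 2 / dual_app phi0 y0) *: y0.
have yE : dual_app phi0 y = (f phi0 + g phi0) / 2 by rewrite dual_appZ divfK.
(* Near [phi0], the bound [f] or [g], the value at [y] and the value at [x] each contribute at most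
   [eta]; together they fill half the gap, the distance from [dual_app phi0 y] to either bound. *)
pose eta := (g phi0 - f phi0) / 6.
have eta0 : 0 < eta by rewrite /eta; lra.
have [r1 r10 fr] := FBL_continuous phi0 Ff eta0.
have [r2 r20 gr] := FBL_continuous phi0 Fg eta0.
have y1 : 0 < `|y| + 1 by rewrite ltr_wpDl.
(* The four bounds control [f], [g], the norm of nearby functionals, and their values at [y]. *)
pose r := Num.min (Num.min r1 r2) (Num.min 1 (eta / (`|y| + 1))).
have r0 : 0 < r by rewrite !lt_min r10 r20 ltr01 divr_gt0.
have rr1 : r <= r1 by rewrite !ge_min lexx.
have rr2 : r <= r2 by rewrite !ge_min lexx orbT.
have rl1 : r <= 1 by rewrite !ge_min lexx !orbT.
have ry : r * `|y| <= eta.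
  apply: (@le_trans _ _ (r * (`|y| + 1))); first by rewrite ler_wpM2l ?lerDl// ltW.
  by rewrite -ler_pdivlMr// !ge_min lexx !orbT.
have M1 : 0 < M + 1 by lra.
pose near phi := forall x, `|dual_app phi x - dual_app phi0 x| <= r * `|x|.
have nearM phi x : near phi -> `|dual_app phi x| <= (M + 1) * `|x|.
  move=> nphi; rewrite -[dual_app phi x](subrK (dual_app phi0 x)) addrC mulrDl.
  apply: le_trans (ler_normD _ _) _; apply: lerD => //.
  by apply: le_trans (nphi x) _; apply: ler_wpM2r.
pose rho := eta / (M + 1).
pose h x := clip f g (delta (y + x)).
have hI x : order_interval f g (h x).
  by apply: clip_order_interval => //; exact: FBL_delta.
have hE phi x : near phi -> `|x| <= rho -> h x phi = dual_app phi (y + x).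
  move=> nphi xrho.
  have xeta : `|dual_app phi x| <= eta.
    apply: le_trans (nearM _ _ nphi) _.
    by rewrite -ler_pdivlMl// mulrC.
  have yeta : `|dual_app phi y - (f phi0 + g phi0) / 2| <= eta.
    by rewrite -yE; apply: le_trans ry.
  have feta : `|f phi - f phi0| <= eta.
    by apply: fr => z; apply: le_trans (nphi z) _; apply: ler_wpM2r.
  have geta : `|g phi - g phi0| <= eta.
    by apply: gr => z; apply: le_trans (nphi z) _; apply: ler_wpM2r.
  move: xeta yeta feta geta; rewrite !ler_norml.
  move=> /andP[x1 x2] /andP[z1 z2] /andP[f1 f2] /andP[g1 g2].
  have etaE : 6 * eta = g phi0 - f phi0 by rewrite /eta; lra.
  by rewrite /h clip_id /delta dual_appD//; lra.
exists rho, ((M + 1) / r), h; split=> //; first by rewrite divr_gt0.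
  by rewrite divr_gt0.
move=> x x' c xrho x'rho hc; set z := x - x'.
have [psi psi1 psiz] := norming_functional z.
(* This sign makes both terms of [phi] agree in sign at [z], so its value there has modulus at least
   r |z|. *)
pose s : R := if 0 <= dual_app phi0 z then 1 else -1.
have s1 : `|s| = 1 by rewrite /s; case: ifP; rewrite ?normrN normr1.
have [phi phiE] := dual_linear_combination 1 (s * r) phi0 psi.
have nphi : near phi.
  move=> w; rewrite phiE mul1r addrAC subrr add0r !normrM s1 mul1r gtr0_norm//.
  by rewrite ler_wpM2l// ltW.
have rz : r * `|z| <= `|dual_app phi z|.
  have rz0 : 0 <= r * `|z| by rewrite mulr_ge0// ltW.
  rewrite phiE psiz mul1r -mulrA /s; case: ifPn => [p0|].
    by rewrite mul1r ger0_norm ?addr_ge0// lerDr.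
  rewrite -ltNge => p0; rewrite mulN1r ler0_norm; lra.
have hxx' : (h x \- h x') phi = dual_app phi z.
  by rewrite /= !hE// -dual_appB; congr dual_app; rewrite opprD addrACA subrr add0r.
have [hH _] : H0 (h x \- h x').
  by apply: H0B; apply: FBL_H0; [have [] := hI x|have [] := hI x'].
have := fbl_le_eval M1 hH hc (fun w => nearM phi w nphi).
rewrite hxx' => /(le_trans rz).
by rewrite mulrAC ler_pdivlMr// mulrC.
Qed.

(** Evaluation at [phi0] maps the convex combinations of [f] and [g] onto the interval from [f phi0]
    to [g phi0], and is continuous by [fbl_le_eval]. *)
Lemma dense_order_interval_infinite D (phi0 : @Dual R E) : f phi0 < g phi0 ->
  dense_in (@fbl_dist R E) (order_interval f g) D -> infinite_set D.
Proof.
move=> fg0 [DI Ddense]; have [M M0 phi0M] := dual_bounded phi0.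
apply: (@dense_itv_infinite R _ D (fun h => h phi0) _ _ fg0) => s e /andP[fs sg] e0.
pose t := (s - f phi0) / (g phi0 - f phi0).
have gf0 : 0 < g phi0 - f phi0 by rewrite subr_gt0.
have t0 : 0 <= t by rewrite divr_ge0 ?subr_ge0// ltW.
have t1 : t <= 1 by rewrite ler_pdivrMr// mul1r lerB.
pose h := (fun phi => (1 - t) * f phi) \+ (fun phi => t * g phi).
have hI : order_interval f g h.
  split; first by apply: FBLD; exact: FBLZ.
  by split=> phi; rewrite /h /=; have := fg phi; nra.
have hs : h phi0 = s.
  rewrite /h /= (_ : _ + _ = f phi0 + t * (g phi0 - f phi0)); last by ring.
  by rewrite divfK ?gt_eqF// addrC subrK.
have e2 : 0 < e / 2 / M by rewrite !divr_gt0.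
have [d Dd hd] := Ddense _ hI _ e2.
exists d => //; rewrite -hs.
have [hH _] : H0 (h \- d).
  by apply: H0B; apply: FBL_H0; [have [] := hI|have [] := DI _ Dd].
have := fbl_le_eval M0 hH (fbl_norm_lt_le hd) phi0M.
rewrite [leRHS]mulrC divfK ?gt_eqF// => /le_lt_trans; apply; lra.
Qed.

End OrderInterval.

Lemma dense_normed_infinite (R : realType) (E : normedModType R) (D : set E) (y : E) :
  y != 0 -> dense_in (@norm_dist R E) [set: E] D -> infinite_set D.
Proof.
move=> y0 [_ Ddense].
apply: (@dense_itv_infinite R _ D (fun x => `|x|) 0 1 ltr01) => s e /andP[s0 _] e0.
have [d Dd xd] := Ddense ((s / `|y|) *: y) I _ e0.
exists d => //; rewrite /norm_dist lte_fin in xd; apply: le_lt_trans xd.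
have {1}-> : s = `|(s / `|y|) *: y|; last exact: ler_dist_dist.
by rewrite normrZ ger0_norm ?divr_ge0// divfK// normr_eq0.
Qed.

Theorem theorem3p2 (R : realType) (E : completeNormedModType R)
    (f g : @Dual R E -> R) :
  FBL f -> FBL g -> (forall phi, f phi <= g phi) -> f <> g ->
  density_eq (@fbl_dist R E) (order_interval f g)
             (@norm_dist R E) [set: E].
Proof.
move=> Ff Fg fg nfg.
have [phi0 fg0] : exists phi0, f phi0 < g phi0.
  apply: contrapT => h; apply: nfg; apply: funext => phi; apply/eqP.
  by rewrite eq_le fg/= leNgt; apply/negP => fgphi; apply: h; exists phi.
split=> D Ddense.
  have [y y0] := dual_neq0 Ff Fg fg0.
  have {}y0 : y != 0 by apply: contraNneq y0 => ->; rewrite dual_app0.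
  have [iota iotaI] := infinite_injection (dense_normed_infinite y0 Ddense).
  have [c cI] := lattice_term_injection iotaI.
  pose ev (t : lattice_term D) := clip f g (term_eval (fun x : D => val x) t).
  exists (range ev); split; last exact: injection_range_card cI.
  split=> [_ [t _ <-]|h [Fh [fh hg]] e e0].
    by apply: clip_order_interval => //; exact: FBL_term_eval.
  have e20 : 0 < e / 2 by lra.
  have [|t ht] := @term_eval_dense _ _ _ (fun x : D => val x) _ h Fh _ e20.
    move=> x d d0; have [z Dz xz] := Ddense.2 x I d d0.
    by exists (SigSub (mem_set Dz)).
  exists (ev t); first by exists t.
  apply: (@fbl_le_norm_lt _ _ _ (e / 2)); last by lra.
  (* As a member of the interval, [h] equals its own clipping. *)
  apply: fbl_le_mono ht => phi /=.
  by rewrite -{1}(clip_id (fh phi) (hg phi)); exact: clip_dist.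
have [iota iotaI] := infinite_injection (dense_order_interval_infinite Ff Fg fg fg0 Ddense).
have [p pI] := infinite_pairing iotaI.
have [rho [C [h [rho0 C0 hI hC]]]] := local_embedding Ff Fg fg fg0.
(* For [(d, n)], a point of the [rho]-ball whose image is within 1/(n+1) of [d] is chosen if there
   is one, with default 0. *)
have /choice[pick pickP] : forall q : D * nat, exists x, forall x',
    `|x'| <= rho -> fbl_le (h x' \- val q.1) q.2.+1%:R^-1 ->
    `|x| <= rho /\ fbl_le (h x \- val q.1) q.2.+1%:R^-1.
  move=> q; have [[x hx]|nex] := pselect (exists x, `|x| <= rho /\
      fbl_le (h x \- val q.1) q.2.+1%:R^-1); first by exists x.
  by exists 0 => x' x'rho hx'; case: nex; exists x'.
(* The precision and the dilation factor, both natural numbers, are absorbed into the infinite set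
   [D] by pairing. *)
pose c (q : D * nat * nat) : D := p (p q.1.1 (iota q.1.2)) (iota q.2).
have cI : injective c.
  move=> [[d n] k] [[d' n'] k'] /pI[/pI[/= dd' nn'] kk'].
  by rewrite dd' (iotaI _ _ nn') (iotaI _ _ kk').
pose w (q : D * nat * nat) : E := q.2.+1%:R *: pick q.1.
exists (range w); split; last exact: injection_range_card cI.
split=> // v _ e e0.
(* Dividing [v] by [k + 1] brings it into the [rho]-ball. *)
pose k := Num.truncn (`|v| / rho).
have k0 : 0 < k.+1%:R :> R by rewrite ltr0Sn.
have vk : `|k.+1%:R^-1 *: v| <= rho.
  rewrite normrZ normfV ger0_norm ?(ltW k0)// ler_pdivrMl// -ler_pdivrMr// ltW//.
  by rewrite truncnS_gt.
(* Two errors of at most 1/(n+1) < e' are amplified by [C], then by [k + 1], and stay below [e]. *)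
pose e' := e / k.+1%:R / (2 * C).
have e'0 : 0 < e' by rewrite !divr_gt0// mulr_gt0.
pose n := Num.truncn e'^-1.
have n0 : 0 < n.+1%:R :> R by rewrite ltr0Sn.
have ne' : n.+1%:R^-1 < e'.
  by rewrite invf_plt ?posrE// truncnS_gt.
have [d Dd hd] := Ddense.2 _ (hI (k.+1%:R^-1 *: v)) n.+1%:R^-1 ltac:(by rewrite invr_gt0).
pose d' : D := SigSub (mem_set Dd).
(* The shrunk vector itself witnesses that the choice at [(d', n)] is not the default. *)
have /= [xrho hx] := pickP (d', n) _ vk (fbl_norm_lt_le hd).
exists (w (d', n, k)); first by exists (d', n, k).
set x := pick _ in xrho hx.
have hvx : fbl_le (h (k.+1%:R^-1 *: v) \- h x) (n.+1%:R^-1 + n.+1%:R^-1).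
  apply: fbl_leD (fbl_norm_lt_le hd) hx => phi /=.
  by apply: le_trans (ler_distD (d phi) _ _) _; rewrite lerD2l distrC.
have := hC _ _ _ vk xrho hvx.
rewrite /norm_dist lte_fin /w /= -/x.
have -> : v - k.+1%:R *: x = k.+1%:R *: (k.+1%:R^-1 *: v - x).
  by rewrite scalerBr scalerA divff ?scale1r// gt_eqF.
rewrite normrZ gtr0_norm// -ltr_pdivlMl// [X in _ < X]mulrC => /le_lt_trans; apply.
have -> : e / k.+1%:R = C * (e' + e').
  by rewrite /e'; field; rewrite !gt_eqF.
by rewrite ltr_pM2l// ltrD.
Qed.
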